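(* Let $G=[V,E]$ be a finite simple bipartite graph with positive vertex weights, positive edge weights and an orientation of its edges. Let $\pi$ be an automorphism of $G$ that is a fixed-point-free involution, and let $\{P_1,P_2\}$ be a partition of $V$ adapted to $\pi$. Let $\tilde{\mathcal{G}}=G/\pi$ be the quotient dicot. If the graph on $P_1$ formed by the solid and dashed edges of $\tilde{\mathcal{G}}$ is bipartite, then \[ Z(G)=\mathcal{Z}(\tilde{\mathcal{G}})^2, \] where $Z(G)$ is the monopole-dimer partition function of $G$ and $\mathcal{Z}(\tilde{\mathcal{G}})$ that of $\tilde{\mathcal{G}}$.
   Context: Dicots and the monopole-dimer model. A dicot $\mathcal{G}=[V,A,B]$ consists of a finite vertex set $V$ and two sets $A$ (solid edges) and $B$ (dashed edges) of unordered pairs of distinct vertices, with $[V,A\cup B]$ bipartite; it carries positive weights $x(v)$ on vertices, $a(\cdot,\cdot)$ on solid edges, $b(\cdot,\cdot)$ on dashed edges, and an orientation of its solid edges ($v\to v'$). A loop is a cyclic sequence $(v_1,\dots,v_{2m})$, $m\ge1$, of distinct vertices (up to rotation) traversed $v_1\to\cdots\to v_{2m}\to v_1$, with a chosen edge $e_j$ joining $v_j,v_{j+1}$ (indices mod $2m$); $m=1$ is a doubled edge, and for $m\ge2$ the two traversal directions give distinct loops. A monopole-dimer configuration is a collection of vertex-disjoint loops, each with an even number of dashed edges; remaining vertices are isolated. Loop weight: $w(\ell)=-\prod_j c_j$ with $c_j=a(v_j,v_{j+1})$ if $e_j$ solid and $v_j\to v_{j+1}$, $c_j=-a(v_j,v_{j+1})$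 if $e_j$ solid and $v_{j+1}\to v_j$, $c_j=\mathrm{i}\,b(v_j,v_{j+1})$ if $e_j$ dashed. Configuration weight: product of loop weights times $\prod x(w)$ over isolated $w$. The partition function $\mathcal{Z}$ is the sum of all configuration weights. For a bipartite graph $G$ with orientation, $Z(G)$ is the partition function of this model on the dicot with solid edges $E$ and no dashed edges. Automorphism: a bijection $V\to V$ preserving adjacency, vertex weights and edge weights. A partition $\{P_1,P_2\}$ of $V$ with $|P_1|=|P_2|$ is adapted to $\pi$ if: (1) $v\in P_1\iff\pi(v)\in P_2$; (2) there is no edge between $v$ and $\pi(v)$ for $v\in P_1$; (3) for each edge $\{v,v'\}$ within $P_1$, the edge $\{\pi(v),\pi(v')\}$ is oriented from $\pi(v)$ to $\pi(v')$ exactly when $\{v,v'\}$ is oriented from $v$ to $v'$; (4) for $v,v'\in P_1$, the edges $\{v,\pi(v')\}$ and $\{v',\pi(v)\}$ are both oriented from $P_1$ to $P_2$ or both from $P_2$ to $P_1$. Quotient dicot $\tilde{\mathcal{G}}=G/\pi$: vertex set $P_1$ with the vertex weights of $G$; solid edges are the edges of $G$ with both endpoints in $P_1$, with the weights and orientations they have in $G$; for distinct $u,v\in P_1$ there is a dashed edge $\{u,v\}$ whenever $\{u,\pi(v)\}$ is an edge of $G$, with weight equal to the weight of that edge.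
   Formalization: Condition (4) of adaptedness is taken with one common direction: all edges between P1 and P2 are oriented from P1 to P2, or all from P2 to P1; if the direction may vary with the pair {v,v'}, the identity fails (two disjoint 4-cycles with unit weights give 25 versus 81). *)

(* Defs.v *)
From mathcomp Require Import all_boot all_order all_algebra all_fingroup.
From mathcomp Require Export complex.

Set Implicit Arguments.
Unset Strict Implicit.
Unset Printing Implicit Defensive.

Import Order.TTheory GRing.Theory Num.Theory.
Local Open Scope ring_scope.
Local Open Scope complex_scope.

Definition bipartite (V : Type) (e : rel V) : Prop :=
  exists c : V -> bool, forall u v, e u v -> c u != c v.

(* Sets of unordered pairs of distinct vertices are symmetric irreflexive
   relations. Weight and orientation functions are only meaningful on edges;
   [orient u v] says that the edge {u, v} is oriented from u to v. *)
Record bigraph (R : rcfType) (V : finType) := BiGraph {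
  gvertex : V -> R;
  gadj : rel V;
  gedge : V -> V -> R;
  gorient : rel V;
  gadj_sym : symmetric gadj;
  gadj_irr : irreflexive gadj;
  gadj_bip : bipartite gadj;
  gvertex_gt0 : forall v, 0 < gvertex v;
  gedge_gt0 : forall u v, gadj u v -> 0 < gedge u v;
  gedge_sym : forall u v, gadj u v -> gedge u v = gedge v u;
  gorientP : forall u v, gadj u v -> gorient u v = ~~ gorient v u }.

Record dicot (R : rcfType) (V : finType) := Dicot {
  dvertex : V -> R;
  solid : rel V;
  solid_weight : V -> V -> R;
  solid_orient : rel V;
  dashed : rel V;
  dashed_weight : V -> V -> R;
  solid_sym : symmetric solid;
  solid_irr : irreflexive solid;
  dashed_sym : symmetric dashed;
  dashed_irr : irreflexive dashed;
  dicot_bip : bipartite (fun u v => solid u v || dashed u v);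
  dvertex_gt0 : forall v, 0 < dvertex v;
  solid_weight_gt0 : forall u v, solid u v -> 0 < solid_weight u v;
  solid_weight_sym :
    forall u v, solid u v -> solid_weight u v = solid_weight v u;
  solid_orientP : forall u v, solid u v -> solid_orient u v = ~~ solid_orient v u;
  dashed_weight_gt0 : forall u v, dashed u v -> 0 < dashed_weight u v;
  dashed_weight_sym :
    forall u v, dashed u v -> dashed_weight u v = dashed_weight v u }.

(* [(u, v, k)] is a traversal step from u to v, along the dashed edge {u, v}
   if [k] holds and along the solid edge {u, v} otherwise. *)
Definition step (V : finType) : finType := (V * V * bool)%type.

Definition step_ok (R : rcfType) (V : finType) (G : dicot R V) (e : step V) :
    bool :=
  let: (u, v, k) := e in if k then dashed G u v else solid G u v.

Definition step_weight (R : rcfType) (V : finType) (G : dicot R V)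
    (e : step V) : R[i] :=
  let: (u, v, k) := e in
  if k then 'i * (dashed_weight G u v)%:C
  else if solid_orient G u v then (solid_weight G u v)%:C
  else - (solid_weight G u v)%:C.

(* The item of index j of [s] is v_j together with the kind of the edge e_j
   joining v_j to its cyclic successor. *)
Definition cyclic_steps (V : finType) (s : seq (V * bool)) : seq (step V) :=
  [seq (p.1.1, p.2.1, p.1.2) | p <- zip s (rot 1 s)].

Definition loop_seq (R : rcfType) (V : finType) (G : dicot R V)
    (s : seq (V * bool)) : bool :=
  [&& (0 < size s)%N, ~~ odd (size s), uniq [seq p.1 | p <- s]
    & all (step_ok G) (cyclic_steps s)].

(* A loop is encoded by its set of steps: since the vertices are distinct, two
   loop sequences have the same set of steps iff they agree up to rotation.
   Distinctness also bounds the length of the sequence by #|V|. For a loop of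
   length 2 the two chosen edges may be of different kinds, but such a loop has
   an odd number of dashed edges and so occurs in no configuration. *)
Definition is_loop (R : rcfType) (V : finType) (G : dicot R V)
    (L : {set step V}) : bool :=
  [exists n : 'I_#|V|.+1, exists s : n.-tuple (V * bool),
     loop_seq G s && (L == [set e in cyclic_steps s])].

Definition loop_vertices (V : finType) (L : {set step V}) : {set V} :=
  [set e.1.1 | e in L].

Definition loop_weight (R : rcfType) (V : finType) (G : dicot R V)
    (L : {set step V}) : R[i] :=
  - \prod_(e in L) step_weight G e.

Definition is_config (R : rcfType) (V : finType) (G : dicot R V)
    (C : {set {set step V}}) : bool :=
  [forall L in C, is_loop G L && ~~ odd #|[set e in L | e.2]|] &&
  [forall L1 in C, forall L2 in C,
     (L1 != L2) ==> [disjoint loop_vertices L1 & loop_vertices L2]].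

Definition config_weight (R : rcfType) (V : finType) (G : dicot R V)
    (C : {set {set step V}}) : R[i] :=
  (\prod_(L in C) loop_weight G L) *
  \prod_(v | v \notin \bigcup_(L in C) loop_vertices L) (dvertex G v)%:C.

Definition dicot_partition (R : rcfType) (V : finType) (G : dicot R V) : R[i] :=
  \sum_(C : {set {set step V}} | is_config G C) config_weight G C.

Lemma solid_only_bip (R : rcfType) (V : finType) (G : bigraph R V) :
  bipartite (fun u v => gadj G u v || false).
Proof. by have [c Hc] := gadj_bip G; exists c => u v; rewrite orbF => /Hc. Qed.

Lemma no_dashed_gt0 (R : rcfType) (V : finType) (u v : V) :
  false -> 0 < (0 : R).
Proof. by []. Qed.

Definition dicot_of_graph (R : rcfType) (V : finType) (G : bigraph R V) :
    dicot R V :=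
  @Dicot R V (gvertex G) (gadj G) (gedge G) (gorient G)
    (fun _ _ => false) (fun _ _ => 0)
    (@gadj_sym _ _ G) (@gadj_irr _ _ G) (fun _ _ => erefl) (fun _ => erefl)
    (solid_only_bip G) (@gvertex_gt0 _ _ G) (@gedge_gt0 _ _ G)
    (@gedge_sym _ _ G) (@gorientP _ _ G) (@no_dashed_gt0 R V)
    (fun _ _ _ => erefl).

Definition graph_partition (R : rcfType) (V : finType) (G : bigraph R V) :
    R[i] :=
  dicot_partition (dicot_of_graph G).

(* Edge orientations need not be preserved. *)
Record automorphism (R : rcfType) (V : finType) (G : bigraph R V)
    (pi : {perm V}) : Prop := Automorphism {
  auto_adj : forall u v, gadj G (pi u) (pi v) = gadj G u v;
  auto_vertex : forall v, gvertex G (pi v) = gvertex G v;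
  auto_edge :
    forall u v, gadj G u v -> gedge G (pi u) (pi v) = gedge G u v }.

(* In [adapted_cross] the direction is common to all pairs v, v'. Letting it
   depend on the unordered pair {v, v'} would not do: the weights of the dashed
   edges of the quotient are positive, so the quotient would not see the
   relative signs of the edges between P1 and P2. *)
Record adapted (R : rcfType) (V : finType) (G : bigraph R V) (pi : {perm V})
    (P1 P2 : {set V}) : Prop := Adapted {
  adapted_cover : P1 :|: P2 = [set: V];
  adapted_disjoint : [disjoint P1 & P2];
  adapted_card : #|P1| = #|P2|;
  adapted_swap : forall v, (v \in P1) = (pi v \in P2);
  adapted_nonadj : forall v, v \in P1 -> ~~ gadj G v (pi v);
  adapted_inner : forall v v', v \in P1 -> v' \in P1 -> gadj G v v' ->
    gorient G (pi v) (pi v') = gorient G v v';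
  adapted_cross :
    (forall v v', v \in P1 -> v' \in P1 -> gadj G v (pi v') ->
       gorient G v (pi v') /\ gorient G v' (pi v)) \/
    (forall v v', v \in P1 -> v' \in P1 -> gadj G v (pi v') ->
       gorient G (pi v') v /\ gorient G (pi v) v') }.

Definition part (V : finType) (P : {set V}) : finType := {v : V | v \in P}.

Definition quotient_solid (R : rcfType) (V : finType) (G : bigraph R V)
    (P1 : {set V}) : rel (part P1) :=
  fun u v => gadj G (val u) (val v).

Definition quotient_dashed (R : rcfType) (V : finType) (G : bigraph R V)
    (pi : {perm V}) (P1 : {set V}) : rel (part P1) :=
  fun u v => (u != v) && gadj G (val u) (pi (val v)).

Lemma quotient_dashed_sym (R : rcfType) (V : finType) (G : bigraph R V)
    (pi : {perm V}) (P1 : {set V}) :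
  automorphism G pi -> involutive pi ->
  symmetric (@quotient_dashed R V G pi P1).
Proof.
move=> aut inv u v; rewrite /quotient_dashed eq_sym; congr (_ && _).
by rewrite -(auto_adj aut) inv gadj_sym.
Qed.

Lemma quotient_dashed_irr (R : rcfType) (V : finType) (G : bigraph R V)
    (pi : {perm V}) (P1 : {set V}) :
  irreflexive (@quotient_dashed R V G pi P1).
Proof. by move=> u; rewrite /quotient_dashed eqxx. Qed.

Lemma quotient_dashed_weight_sym (R : rcfType) (V : finType) (G : bigraph R V)
    (pi : {perm V}) (P1 : {set V}) (u v : part P1) :
  automorphism G pi -> involutive pi -> quotient_dashed G pi u v ->
  gedge G (val u) (pi (val v)) = gedge G (val v) (pi (val u)).
Proof.
move=> aut inv /andP[_ e_uv].
by rewrite -(auto_edge aut e_uv) inv gedge_sym // -[val v]inv (auto_adj aut).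
Qed.

Definition quotient_dicot (R : rcfType) (V : finType) (G : bigraph R V)
    (pi : {perm V}) (P1 : {set V}) (aut : automorphism G pi)
    (inv : involutive pi)
    (bip : bipartite (fun u v : part P1 =>
             quotient_solid G u v || quotient_dashed G pi u v)) :
    dicot R (part P1) :=
  @Dicot R (part P1) (fun v => gvertex G (val v))
    (@quotient_solid R V G P1)
    (fun u v => gedge G (val u) (val v))
    (fun u v => gorient G (val u) (val v))
    (@quotient_dashed R V G pi P1)
    (fun u v => gedge G (val u) (pi (val v)))
    (fun u v => gadj_sym G (val u) (val v))
    (fun u => gadj_irr G (val u))
    (quotient_dashed_sym aut inv)
    (@quotient_dashed_irr R V G pi P1)
    bip
    (fun v => gvertex_gt0 G (val v))
    (fun u v e => gedge_gt0 e)
    (fun u v e => gedge_sym e)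
    (fun u v e => gorientP e)
    (fun u v e => gedge_gt0 (andP e).2)
    (fun u v e => quotient_dashed_weight_sym aut inv e).

(* Main.v *)
Require Import Defs.
From mathcomp Require Import all_boot all_order all_algebra all_fingroup.
Set Implicit Arguments.
Unset Strict Implicit.
Unset Printing Implicit Defensive.
Import Order.TTheory GRing.Theory Num.Theory.
Local Open Scope ring_scope.

(* The partition function of a dicot is the determinant of its Kasteleyn matrix
   K, with the vertex weights on the diagonal and, off it, the signed solid
   weight plus i times the dashed weight. In the Leibniz expansion, a
   permutation together with a choice of edge kinds is a collection of vertex
   disjoint directed loops of even length, each contributing the sign -1, and
   reversing a loop with an odd number of dashed edges changes the sign of its
   weight, so that collections containing such a loop cancel.

   Writing A and B for the solid-and-vertex part and the dashed part of the
   quotient, adaptedness says that K(G) has the block form [[A, B], [-B, A]] up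
   to the sign of B, hence det K(G) = det (A + iB) det (A - iB). Since the
   quotient is bipartite, A - iB is obtained from A + iB by a transposition and
   a conjugation by a diagonal matrix of signs, so both factors are equal. *)

(** * Orbits of permutations, and reversal along a single orbit *)

Section PermOrbits.
Variable V : finType.
Implicit Types (s t : {perm V}) (O : {set V}) (k : {ffun V -> bool}).

Lemma porbit_mem s v u : u \in porbit s v -> s u \in porbit s v.
Proof.
by case/porbitP=> i ->; apply/porbitP; exists i.+1; rewrite expgSr permM.
Qed.

Lemma porbit_permE s v u : (s u \in porbit s v) = (u \in porbit s v).
Proof. by rewrite -!eq_porbit_mem -[s u](_ : (s ^+ 1)%g u = _) ?porbit_perm. Qed.

Lemma porbit_subP s v (P : pred V) :
  P v -> (forall u, P u -> P (s u)) -> forall u, u \in porbit s v -> P u.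
Proof.
move=> Pv Ps u /porbitP[i ->]; elim: i => [|i IHi]; first by rewrite expg0 perm1.
by rewrite expgSr permM; apply: Ps.
Qed.

Lemma porbits_partition s : partition (porbits s) [set: V].
Proof.
suff -> : porbits s = equivalence_partition (fun u v => u \in porbit s v) setT.
  apply/equivalence_partitionP => x y z _ _ _.
  by rewrite porbit_id -!eq_porbit_mem; split=> // /eqP->.
apply/setP => O; apply/imsetP/imsetP => -[v _ ->]; exists v => //.
all: by apply/setP => u; rewrite !inE /= porbit_sym.
Qed.

Lemma big_porbits (S : Type) (idx : S) (op : Monoid.com_law idx) s (F : V -> S) :
  \big[op/idx]_v F v = \big[op/idx]_(O in porbits s) \big[op/idx]_(v in O) F v.
Proof.
rewrite -(set_partition_big _ (porbits_partition s)).
by apply: eq_bigl => v; rewrite inE.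
Qed.

(** The parity of a permutation is that of [#|V|] plus its number of orbits, so the sign splits over
    orbits. An orbit of even size receives -1, the sign in a loop weight, and a fixed point receives
    1. *)
Lemma signr_porbits (A : comPzRingType) s :
  (-1) ^+ s = \prod_(O in porbits s) - (-1) ^+ #|O| :> A.
Proof.
rewrite prodrN -expr_sum -(card_partition (porbits_partition s)) cardsT.
by rewrite /odd_perm signr_addb !signr_odd mulrC.
Qed.

Lemma porbit_trivial s v : (#|porbit s v| <= 1)%N = (s v == v).
Proof.
apply/idP/eqP => [/card_le1_eqP le1 | sv].
  by apply: le1; rewrite ?porbit_permE porbit_id.
rewrite -(cards1 v); apply/subset_leq_card/subsetP => u.
by move/(@porbit_subP s v (fun u => u \in [set v])); apply;
  rewrite ?inE // => x; rewrite inE => /eqP->; rewrite sv inE.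
Qed.

Lemma eq_in_porbit s t v :
  {in porbit t v, s =1 t} -> porbit s v = porbit t v.
Proof.
move=> st; have it i : (s ^+ i)%g v = (t ^+ i)%g v.
  elim: i => [|i IHi]; first by rewrite !expg0.
  by rewrite !expgSr !permM IHi st // mem_porbit.
by apply/setP => u; apply/porbitP/porbitP => -[i ->]; exists i; rewrite it.
Qed.


Lemma porbit_permV s v u : (s^-1%g u \in porbit s v) = (u \in porbit s v).
Proof. by rewrite -porbit_permE permKV. Qed.

(** An orbit and its complement are both stable under [s] and its inverse, so values taken on the
    orbit never meet values taken off it. *)
Lemma flip_inj s v0 :
  injective (fun v => if v \in porbit s v0 then s^-1%g v else s v).
Proof.
move=> u v; case: ifP => uO; case: ifP => vO; try exact: perm_inj.
- by move=> E; have := porbit_permE s v0 v; rewrite -E porbit_permV uO vO.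
- by move=> E; have := porbit_permE s v0 u; rewrite E porbit_permV uO vO.
Qed.

Definition flip s v0 : {perm V} := perm (@flip_inj s v0).

(** A kind is attached to the step leaving a vertex. After reversal, the step leaving [v] is the
    former step arriving at [v], whose kind was stored at its source. *)
Definition flip_kind s k v0 : {ffun V -> bool} :=
  [ffun v => if v \in porbit s v0 then k (s^-1%g v) else k v].

Lemma porbit_flip s v0 v : porbit (flip s v0) v = porbit s v.
Proof.
case v_v0: (v \in porbit s v0).
  rewrite -[RHS]porbitV; apply: eq_in_porbit => u.
  rewrite porbitV permE -eq_porbit_mem => /eqP u_v.
  by rewrite -eq_porbit_mem u_v eq_porbit_mem v_v0.
apply: eq_in_porbit => u; rewrite permE -eq_porbit_mem => /eqP u_v.
by rewrite -eq_porbit_mem u_v eq_porbit_mem v_v0.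
Qed.

Lemma porbits_flip s v0 : porbits (flip s v0) = porbits s.
Proof. by apply: eq_imset => v; rewrite porbit_flip. Qed.

Lemma flipK s v0 : flip (flip s v0) v0 = s.
Proof.
apply/permP => v; rewrite [LHS]permE porbit_flip; case: ifP => vO; last first.
  by rewrite permE vO.
by apply: (canLR (permK _)); rewrite permE porbit_permE vO permK.
Qed.

Lemma flipV s v0 v : v \in porbit s v0 -> (flip s v0)^-1%g v = s v.
Proof. by move=> vO; apply: (canLR (permK _)); rewrite permE porbit_permE vO permK. Qed.

Lemma flip_kindK s k v0 : flip_kind (flip s v0) (flip_kind s k v0) v0 = k.
Proof.
apply/ffunP => v; rewrite !ffunE porbit_flip; case: ifP => vO; last by rewrite ?vO.
by rewrite flipV // porbit_permE vO permK.
Qed.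

Lemma odd_flip s v0 : odd_perm (flip s v0) = odd_perm s.
Proof. by rewrite /odd_perm porbits_flip. Qed.

(** On the reversed orbit, [s] maps the old sources of dashed steps bijectively onto the new ones;
    elsewhere nothing changes. *)
Lemma card_flip_kind s k v0 v :
  #|[set u in porbit s v | flip_kind s k v0 u]| =
  #|[set u in porbit s v | k u]|.
Proof.
case v_v0: (v \in porbit s v0).
  rewrite -[RHS](card_imset _ (@perm_inj _ s)); apply: eq_card => u.
  have uO w : w \in porbit s v -> w \in porbit s v0.
    by rewrite -eq_porbit_mem => /eqP w_v; rewrite -eq_porbit_mem w_v eq_porbit_mem.
  apply/idP/imsetP => [|[w]]; rewrite !inE ffunE.
    by move=> /andP[us]; rewrite uO // => kv; exists (s^-1%g u);
       rewrite ?permKV // inE porbit_permV us.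
  by move=> /andP[ws kw] ->; rewrite porbit_permE ws porbit_permE uO // permK.
apply: eq_card => u; rewrite !inE ffunE; case: (boolP (u \in porbit s v)) => //=.
by rewrite -eq_porbit_mem => /eqP u_v; rewrite -eq_porbit_mem u_v eq_porbit_mem v_v0.
Qed.

End PermOrbits.

(** * Leibniz expansion of the Kasteleyn determinant and cancellation of odd orbits *)

Section Expansion.
Variables (R : rcfType) (V : finType) (G : dicot R V).
Implicit Types (s t : {perm V}) (O : {set V}) (k : {ffun V -> bool}).
Implicit Types (x : {perm V} * {ffun V -> bool}).

(* A fixed point of the permutation is an isolated vertex; it is counted once,
   with the kind [false]. *)
Definition entry (e : step V) : R[i]%C :=
  if step_ok G e then step_weight G e
  else if (e.1.1 == e.1.2) && ~~ e.2 then (dvertex G e.1.1)%:C%C else 0.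

Definition kasteleyn (u v : V) : R[i]%C := entry (u, v, false) + entry (u, v, true).

(** This is the determinant of [K], written over [V] itself so that no ordering of the vertices has
    to be chosen. *)
Definition leibniz (K : V -> V -> R[i]%C) : R[i]%C :=
  \sum_(s : {perm V}) (-1) ^+ s * \prod_v K v (s v).

Definition term x : R[i]%C :=
  (-1) ^+ x.1 * \prod_v entry (v, x.1 v, x.2 v).

Definition even_orbits x :=
  [forall v, ~~ odd #|[set u in porbit x.1 v | x.2 u]|].

Lemma leibniz_terms : leibniz kasteleyn = \sum_x term x.
Proof.
rewrite /leibniz (eq_bigr (fun s => \sum_(k : {ffun V -> bool}) term (s, k))).
  by rewrite pair_bigA; apply: eq_bigr => -[].
move=> s _; rewrite /term /= -big_distrr /=; congr (_ * _).
rewrite -(bigA_distr_bigA (fun v b => entry (v, s v, b))).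
by apply: eq_bigr => v _; rewrite big_bool /kasteleyn addrC.
Qed.

Lemma step_ok_irr v b : step_ok G (v, v, b) = false.
Proof. by case: b; rewrite /= (dashed_irr, solid_irr). Qed.

Lemma step_ok_sym u v b : step_ok G (u, v, b) = step_ok G (v, u, b).
Proof. by case: b; rewrite /= (dashed_sym, solid_sym). Qed.

(** Solid entries are antisymmetric because of the orientation; dashed ones are symmetric, their
    factor ['i] being blind to direction. *)
Lemma entry_rev u v b : u != v -> entry (v, u, b) = - (-1) ^+ b * entry (u, v, b).
Proof.
move=> neq_uv; rewrite /entry step_ok_sym /= eq_sym (negbTE neq_uv) /=.
case: ifP => [|_]; last by rewrite mulr0.
case: b => /= uv; first by rewrite (dashed_weight_sym uv) expr1 opprK mul1r.
rewrite (solid_weight_sym uv) expr0 mulN1r (solid_orientP uv).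
by case: (solid_orient G v u); rewrite ?opprK.
Qed.

(** Each step changes the colour of the bipartition, so [s] exchanges the two colour classes of the
    orbit, which therefore have the same size. *)
Lemma orbit_even s k v :
  (forall u, u \in porbit s v -> step_ok G (u, s u, k u)) ->
  ~~ odd #|porbit s v|.
Proof.
have [c Hc] := dicot_bip G => ok; set O := porbit s v.
have flipc u : u \in O -> c (s u) = ~~ c u.
  move=> uO; have /Hc : solid G u (s u) || dashed G u (s u).
    by have := ok u uO; rewrite /=; case: (k u) => ->; rewrite ?orbT.
  by case: (c u) (c (s u)) => [] [].
have le b : (#|[set u in O | c u == b]| <= #|[set u in O | c u == ~~ b]|)%N.
  rewrite -(card_imset _ (@perm_inj _ s)); apply/subset_leq_card/subsetP => w.
  case/imsetP=> u; rewrite !inE => /andP[uO /eqP cu] ->.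
  by rewrite porbit_permE uO flipc // cu eqxx.
have -> : #|O| = (#|[set u in O | c u == true]| + #|[set u in O | c u == false]|)%N.
  rewrite -(cardsID [set u | c u == true] O); congr (_ + _)%N; apply: eq_card => u.
    by rewrite !inE.
  by rewrite !inE andbC; case: (c u).
have -> : #|[set u in O | c u == true]| = #|[set u in O | c u == false]|.
  by apply/eqP; rewrite eqn_leq (le true) (le false).
by rewrite addnn odd_double.
Qed.

Definition flip_pair x v : {perm V} * {ffun V -> bool} :=
  (flip x.1 v, flip_kind x.1 x.2 v).

(* The vertex is picked in the union of the odd orbits, which [flip_pair] does
   not change: this makes the reversal an involution. *)
Definition reverse_odd x :=
  if [pick v | odd #|[set u in porbit x.1 v | x.2 u]|] is Some v
  then flip_pair x v else x.

Lemma reverse_oddK : involutive reverse_odd.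
Proof.
move=> x; case E: [pick v | odd #|[set u in porbit x.1 v | x.2 u]|] => [v|]; last first.
  have Ex : reverse_odd x = x by rewrite /reverse_odd E.
  by rewrite !Ex.
have -> : reverse_odd x = flip_pair x v by rewrite /reverse_odd E.
rewrite /reverse_odd (eq_pick (Q := fun u => odd #|[set w in porbit x.1 u | x.2 w]|)).
  by rewrite E /flip_pair /= flipK flip_kindK; case: x {E}.
by move=> u; rewrite /= porbit_flip card_flip_kind.
Qed.

Lemma even_reverse_odd x : even_orbits (reverse_odd x) = even_orbits x.
Proof.
rewrite /reverse_odd; case: pickP => // v _.
by apply: eq_forallb => u /=; rewrite porbit_flip card_flip_kind.
Qed.

(** Reversal keeps the parity of the permutation and changes the sign of every solid entry on the
    orbit. The orbit has even length and an odd number of dashed steps, hence an odd number of solid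
    ones. *)
Lemma term_reverse_odd x : ~~ even_orbits x -> term (reverse_odd x) = - term x.
Proof.
rewrite /reverse_odd; case: pickP => [v0 v0P | none] /=; last first.
  by case/negP; apply/forallP => v; rewrite none.
move=> _; case: x v0P => s k /= v0P; rewrite /term /= odd_flip -mulrN; congr (_ * _).
set O := porbit s v0 in v0P *.
rewrite (bigID (mem O)) [in RHS](bigID (mem O)) /= -mulNr; congr (_ * _); last first.
  by apply: eq_bigr => u uO; rewrite permE ffunE -/O (negbTE uO).
(* Indexing the reversed steps by their target instead of their source makes each one face the
   original step along the same edge. *)
have -> : \prod_(u in O) entry (u, flip s v0 u, flip_kind s k v0 u) =
          \prod_(u in O) entry (s u, u, k u).
  rewrite (reindex_inj (@perm_inj _ s)); apply: eq_big => u; rewrite porbit_permE // => uO.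
  by rewrite permE ffunE porbit_permE uO permK.
have [ok | notok] := boolP [forall u in O, step_ok G (u, s u, k u)]; last first.
  have [u uO nok] : exists2 u, u \in O & ~~ step_ok G (u, s u, k u).
    by move: notok; rewrite negb_forall_in => /exists_inP.
  (* A vertex weight cannot occur here: a fixed point of kind [false] would be a whole orbit without
     dashed steps, while [O] has an odd number of them. So both products vanish. *)
  have k_fix : (u == s u) && ~~ k u = false.
    apply/negP => /andP[/eqP/esym/eqP su ku]; case/negP: v0P.
    have O1 : porbit s u = [set u].
      apply/eqP; rewrite eq_sym eqEcard cards1 porbit_trivial su andbT sub1set.
      exact: porbit_id.
    rewrite /O in uO *; move: uO; rewrite -eq_porbit_mem => /eqP <-.
    rewrite O1 (_ : [set w in _ | _] = set0) ?cards0 //; apply/setP => w.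
    by rewrite !inE; case: eqP => // ->; rewrite (negbTE ku).
  have z1 : entry (u, s u, k u) = 0 by rewrite /entry (negbTE nok) /= k_fix.
  have z2 : entry (s u, u, k u) = 0.
    by rewrite /entry step_ok_sym (negbTE nok) /= eq_sym k_fix.
  by rewrite (bigD1 u uO) z2 [in RHS](bigD1 u uO) /= z1 !mul0r oppr0.
have okP u : u \in O -> step_ok G (u, s u, k u) by move/(forall_inP ok).
rewrite (eq_bigr (fun u => (- (-1) ^+ k u) * entry (u, s u, k u))); last first.
  move=> u uO; rewrite entry_rev //; apply: contraTneq (okP u uO) => <-.
  by rewrite step_ok_irr.
rewrite big_split /= -[RHS]mulN1r; congr (_ * _).
rewrite prodrN -signr_odd (negbTE (orbit_even okP)) mul1r.
rewrite -expr_sum (_ : (\sum_(u in O) k u)%N = #|[set u in O | k u]|).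
  by rewrite -signr_odd v0P.
rewrite -sum1_card big_mkcond [RHS]big_mkcond; apply: eq_bigr => u _.
by rewrite inE; case: (u \in O) (k u) => [] [].
Qed.

Definition ok_steps x :=
  [forall v, step_ok G (v, x.1 v, x.2 v) || (v == x.1 v) && ~~ x.2 v].

(** The involution [reverse_odd] shows that the terms with an odd orbit have a sum equal to its own
    opposite, hence zero. Any other term lost has a zero entry. *)
Lemma sum_terms : \sum_x term x = \sum_(x | even_orbits x && ok_steps x) term x.
Proof.
rewrite (bigID even_orbits) /= [X in _ + X](_ : _ = 0) ?addr0; last first.
  set S := \sum_(_ | _) _.
  have : S = - S.
    rewrite {1}/S (reindex_inj (inv_inj reverse_oddK)) -sumrN.
    by apply: eq_big => x; rewrite even_reverse_odd // => /term_reverse_odd.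
  by move/eqP; rewrite -addr_eq0 -mulr2n mulrn_eq0 => /eqP.
rewrite (bigID ok_steps) /= [X in _ + X](_ : _ = 0) ?addr0 // big1 // => x.
case/andP=> _; rewrite negb_forall => /existsP[v]; rewrite negb_or => /andP[n1 n2].
by rewrite /term (bigD1 v) //= /entry (negbTE n1) /= (negbTE n2) mul0r mulr0.
Qed.

End Expansion.

(** * Loops as orbits of permutations decorated with edge kinds *)

Section Configurations.
Variables (R : rcfType) (V : finType) (G : dicot R V).
Implicit Types (s t : {perm V}) (O : {set V}) (k : {ffun V -> bool}).
Implicit Types (x : {perm V} * {ffun V -> bool}) (L : {set step V}).

Definition steps x O : {set step V} := [set (u, x.1 u, x.2 u) | u in O].

(** Orbits of size one are left out: they are the isolated vertices. *)
Definition orbit_loops x : {set {set step V}} :=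
  [set steps x O | O in [set O in porbits x.1 | (1 < #|O|)%N]].

Lemma steps_inj x : injective (fun u : V => (u, x.1 u, x.2 u) : step V).
Proof. by move=> u v []. Qed.

Lemma loop_vertices_steps x O : loop_vertices (steps x O) = O.
Proof.
apply/setP => u; apply/imsetP/idP => [[e /imsetP[v vO ->] -> //]|uO].
by exists (u, x.1 u, x.2 u) => //; apply: imset_f.
Qed.

Lemma card_dashed_steps x O :
  #|[set e in steps x O | e.2]| = #|[set u in O | x.2 u]|.
Proof.
rewrite -[RHS](card_imset _ (@steps_inj x)); apply: eq_card => e.
apply/idP/imsetP => [|[u]]; rewrite !inE.
  by case/andP=> /imsetP[u uO ->] /= ku; exists u; rewrite // inE uO.
by case/andP=> uO ku ->; rewrite imset_f.
Qed.

Lemma cyclic_steps_map s k (r : seq V) : rot 1 r = map s r ->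
  cyclic_steps [seq (u, k u) | u <- r] = [seq (u, s u, k u) | u <- r].
Proof.
move=> rs; rewrite /cyclic_steps -map_rot rs -map_comp zip_map -map_comp.
by apply: eq_map.
Qed.

Lemma map_traject (T : Type) (f : T -> T) y n :
  map f (traject f y n) = traject f (f y) n.
Proof. by elim: n y => //= n IHn y; rewrite IHn. Qed.

Lemma fcycle_traject (T : eqType) (f : T -> T) y (r : seq T) :
  fcycle f (y :: r) -> y :: r = traject f y (size r).+1.
Proof.
move/fpathE; rewrite size_rcons trajectSr => /rcons_inj[rE _].
by rewrite {1}rE.
Qed.

Lemma is_loop_steps x v :
  (forall u, u \in porbit x.1 v -> step_ok G (u, x.1 u, x.2 u)) ->
  is_loop G (steps x (porbit x.1 v)).
Proof.
case: x => s k /= ok; set n := #|porbit s v|.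
have le_n : (n < #|V|.+1)%N by rewrite ltnS max_card.
pose q := [seq (u, k u) | u <- traject s v n].
have sz : size q == n by rewrite size_map size_traject.
have cq : cyclic_steps q = [seq (u, s u, k u) | u <- traject s v n].
  apply: cyclic_steps_map; rewrite map_traject.
  (* The trajectory of [v] closes up after [n] steps, so rotating it by one is the same as applying
     [s] to it. *)
  have := iter_porbit s v; rewrite -/n.
  case: n {q le_n sz} => // n iv.
  by rewrite trajectS rot1_cons trajectSr -iterSr iv.
apply/existsP; exists (Ordinal le_n); apply/existsP; exists (Tuple sz).
rewrite /loop_seq /= cq (eqP sz) lt0n card_porbit_neq0 (orbit_even ok) /=.
rewrite -map_comp map_id uniq_traject_porbit /= all_map; apply/andP; split.
  by apply/allP => u /=; rewrite -porbit_traject => /ok.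
apply/eqP/setP => e; rewrite inE; apply/imsetP/mapP => -[u uO ->]; exists u => //.
  by rewrite -porbit_traject.
by rewrite porbit_traject.
Qed.

(** The permutation is the cyclic successor along the vertex list of the loop, which fixes all other
    vertices. *)
Lemma is_loopP L : is_loop G L ->
  exists x v, L = steps x (porbit x.1 v) /\
    forall u, u \in porbit x.1 v -> step_ok G (u, x.1 u, x.2 u).
Proof.
case/existsP=> m /existsP[q /andP[/and4P[q0 _ Uq /allP ok] /eqP ->]].
have {m q q0 Uq ok} [q [q0 Uq ok ->]] : exists q' : seq (V * bool),
   [/\ (0 < size q')%N, uniq [seq p.1 | p <- q'],
       {in cyclic_steps q', forall e, step_ok G e}
     & [set e in cyclic_steps q] = [set e in cyclic_steps q']].
  by exists (val q).
set r := [seq p.1 | p <- q] in Uq.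
pose s := perm (can_inj (prev_next Uq)).
(* The list [r] has no repetition, so [index] recovers the kind stored with [u]; off the loop the
   default [false] is returned. *)
pose k := [ffun u => nth false [seq p.2 | p <- q] (index u r)].
have sE : s =1 next r by move=> u; rewrite permE.
have qE : q = [seq (u, k u) | u <- r].
  case: (q) q0 @r Uq @k {s sE ok} => // p0 q1 _ r Uq k.
  apply: (@eq_from_nth _ p0) => [|i lt_i]; first by rewrite !size_map.
  rewrite (nth_map p0.1) ?size_map // ffunE index_uniq ?size_map //.
  by rewrite /r !(nth_map p0) //; case: nth.
have rot_r : rot 1 r = map s r.
  rewrite (eq_map sE); have := cycle_next Uq.
  case: (r) => // y r' /[dup] /fcycle_traject rE; rewrite /= => /fpathE.
  by rewrite rot1_cons size_rcons -map_traject => ->; rewrite -rE.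
have cq : cyclic_steps q = [seq (u, s u, k u) | u <- r].
  by rewrite qE; apply: cyclic_steps_map.
have [y yr] : exists y, y \in r.
  by case: (q) q0 @r {Uq s k sE qE rot_r cq ok} => // p0 q1 _; exists p0.1; rewrite /= inE eqxx.
have rO : porbit s y =i r.
  move=> u; apply/idP/idP.
    by apply: (porbit_subP (P := fun u => u \in r)) => // w; rewrite sE mem_next.
  (* Rotating the cycle to start at [y] turns it into a trajectory of [y]. *)
  have := cycle_next Uq; case/rot_to: yr => i r' rE.
  rewrite -(rot_cycle i) rE => /fcycle_traject rE'.
  rewrite -(mem_rot i) rE rE' => /trajectP[j _ ->].
  by rewrite -(eq_iter sE) -permX mem_porbit.
exists (s, k), y; split=> [|u]; last first.
  by rewrite rO => ur; apply: ok; rewrite cq; apply: (map_f (fun u => (u, s u, k u))).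
apply/setP => e; rewrite inE cq; apply/mapP/imsetP => -[u ur ->]; exists u => //.
  by rewrite rO.
by rewrite -rO.
Qed.

End Configurations.

(** * Bijection between the surviving terms and the configurations *)

Section LoopExpansion.
Variables (R : rcfType) (V : finType) (G : dicot R V).
Implicit Types (s t : {perm V}) (O : {set V}) (k : {ffun V -> bool}).
Implicit Types (x : {perm V} * {ffun V -> bool}) (L : {set step V}).

Lemma orbit_loopsP x L :
  reflect (exists v, x.1 v != v /\ L = steps x (porbit x.1 v)) (L \in orbit_loops x).
Proof.
apply: (iffP imsetP) => [[O]|[v [sv ->]]].
  rewrite inE => /andP[/imsetP[v _ ->]]; rewrite ltnNge porbit_trivial => sv ->.
  by exists v.
by exists (porbit x.1 v); rewrite // inE imset_f //= ltnNge porbit_trivial.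
Qed.

(** The union of the loops is the graph of [x] over the vertices it moves, from which [x] can be
    read back. *)
Lemma mem_bigcup_steps x e :
  (e \in \bigcup_(L in orbit_loops x) L) =
  (x.1 e.1.1 != e.1.1) && (e == (e.1.1, x.1 e.1.1, x.2 e.1.1)).
Proof.
apply/bigcupP/andP => [[L /orbit_loopsP[v [sv ->]] /imsetP[u uO ->]] /= | [sv /eqP eE]].
  split=> //; rewrite -porbit_trivial.
  by move: uO; rewrite -eq_porbit_mem => /eqP->; rewrite porbit_trivial.
exists (steps x (porbit x.1 e.1.1)); first by apply/orbit_loopsP; exists e.1.1.
by rewrite eE; apply: imset_f; rewrite /= porbit_id.
Qed.

Lemma mem_loop_cover x v :
  (v \in \bigcup_(L in orbit_loops x) loop_vertices L) = (x.1 v != v).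
Proof.
apply/bigcupP/idP => [[L /orbit_loopsP[u [su ->]]]|sv].
  rewrite loop_vertices_steps -eq_porbit_mem => /eqP vu.
  by rewrite -porbit_trivial vu porbit_trivial.
exists (steps x (porbit x.1 v)); first by apply/orbit_loopsP; exists v.
by rewrite loop_vertices_steps porbit_id.
Qed.

Lemma ok_stepsP x v : ok_steps G x -> x.1 v != v ->
  forall u, u \in porbit x.1 v -> step_ok G (u, x.1 u, x.2 u).
Proof.
move=> /forallP okx sv u; have /orP[//|/andP[/eqP su _]] := okx u.
rewrite -eq_porbit_mem => /eqP uv.
by move: sv; rewrite -porbit_trivial -uv porbit_trivial -su eqxx.
Qed.

Lemma orbit_loops_config x : even_orbits x -> ok_steps G x ->
  is_config G (orbit_loops x).
Proof.
move=> /forallP ev ok; apply/andP; split.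
  apply/forall_inP => L /orbit_loopsP[v [sv ->]].
  by rewrite card_dashed_steps ev is_loop_steps // => u; apply: ok_stepsP.
apply/forall_inP => L1 /orbit_loopsP[v1 [_ ->]].
apply/forall_inP => L2 /orbit_loopsP[v2 [_ ->]]; apply/implyP => ne.
rewrite !loop_vertices_steps -setI_eq0; apply: contraR ne => /set0Pn[u].
by rewrite inE -!eq_porbit_mem => /andP[/eqP <- /eqP <-].
Qed.

Lemma orbit_loops_inj :
  {in [pred x | even_orbits x && ok_steps G x] &, injective (@orbit_loops V)}.
Proof.
move=> x y; rewrite !inE => /andP[_ okx] /andP[_ oky] exy.
have mem e : (e \in \bigcup_(L in orbit_loops x) L) = (e \in \bigcup_(L in orbit_loops y) L).
  by rewrite exy.
have fixed z v : ok_steps G z -> z.1 v = v -> z.2 v = false.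
  move=> /forallP/(_ v)/orP[] + zv; rewrite zv ?step_ok_irr // => /andP[_].
  exact: negbTE.
have xy v : (x.1 v, x.2 v) = (y.1 v, y.2 v).
  have := mem (v, x.1 v, x.2 v); rewrite !mem_bigcup_steps /= eqxx andbT.
  have [xv|] /= := eqVneq (x.1 v) v; last by move=> _ /esym/andP[_ /eqP[-> ->]].
  (* A vertex fixed by the first permutation is fixed by the second as well, and both kinds are then
     [false], since no step joins a vertex to itself. *)
  have := mem (v, y.1 v, y.2 v); rewrite !mem_bigcup_steps /= eqxx andbT xv eqxx /=.
  by case: eqVneq => // yv _ _; rewrite yv !fixed.
case: x y {exy mem okx oky} xy => s k [t l] /= xy; congr (_, _).
  by apply/permP => v; case: (xy v).
by apply/ffunP => v; case: (xy v).
Qed.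

(** Each loop of [C] comes from some pair; as the loops are disjoint, these pairs can be glued into
    one that fixes the isolated vertices. *)
Lemma orbit_loops_onto C : is_config G C ->
  exists x, [/\ even_orbits x, ok_steps G x & orbit_loops x = C].
Proof.
case/andP=> /forall_inP loopC /forall_inP disjC.
(* A pair [x0 L] is chosen for every set [L] at once, with a dummy value outside [C]. *)
have /fin_all_exists[x0 x0P] L : exists x, L \in C -> exists v,
    L = steps x (porbit x.1 v) /\
    forall u, u \in porbit x.1 v -> step_ok G (u, x.1 u, x.2 u).
  case LC: (L \in C); last by exists (1%g, [ffun _ => false]).
  by have /andP[/is_loopP[x xP] _] := loopC _ LC; exists x.
have uniqC L1 L2 u : L1 \in C -> L2 \in C ->
    u \in loop_vertices L1 -> u \in loop_vertices L2 -> L1 = L2.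
  move=> L1C L2C u1 u2; apply/eqP; apply: contraT => ne.
  have /forall_inP/(_ _ L2C) := disjC _ L1C; rewrite ne => /disjointFr/(_ u1).
  by rewrite u2.
have LP L u : L \in C -> u \in loop_vertices L ->
    L = steps (x0 L) (porbit (x0 L).1 u) /\
    forall w, w \in porbit (x0 L).1 u -> step_ok G (w, (x0 L).1 w, (x0 L).2 w).
  move=> LC; have [v [LE ok]] := x0P L LC.
  by rewrite {1}LE loop_vertices_steps -eq_porbit_mem => /eqP->.
pose f v : V * bool :=
  if [pick L in C | v \in loop_vertices L] is Some L then ((x0 L).1 v, (x0 L).2 v)
  else (v, false).
have fE L v : L \in C -> v \in loop_vertices L -> f v = ((x0 L).1 v, (x0 L).2 v).
  rewrite /f => LC vL; case: pickP => [L' /andP[L'C vL']|/(_ L)]; last by rewrite LC vL.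
  by rewrite (uniqC _ _ _ LC L'C vL vL').
have memf L v : L \in C -> v \in loop_vertices L -> (f v).1 \in loop_vertices L.
  move=> LC vL; rewrite (fE L) //=; have [LE _] := LP L v LC vL.
  by rewrite {2}LE loop_vertices_steps porbit_mem ?porbit_id.
have fN v : (forall L, L \in C -> v \notin loop_vertices L) -> f v = (v, false).
  by move=> nv; rewrite /f; case: pickP => // L /andP[/nv/negP].
have inC v : (exists2 L, L \in C & v \in loop_vertices L) \/
             (forall L, L \in C -> v \notin loop_vertices L).
  have [/existsP[L /andP[? ?]]|] := boolP [exists L, (L \in C) && (v \in loop_vertices L)].
    by left; exists L.
  by rewrite negb_exists => /forallP nv; right=> L LC; have := nv L; rewrite LC.
(* By [memf] the image of a vertex stays on its loop, so two vertices with the same image lie on the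
   same loop or are both isolated. *)
have f_inj : injective (fun v => (f v).1).
  move=> u v /= fuv; case: (inC u) => [[L LC uL]|nu]; case: (inC v) => [[M MC vM]|nv].
  - have EM : L = M by apply: (uniqC _ _ _ LC MC (memf L u LC uL)); rewrite fuv memf.
    by move: fuv; rewrite (fE L) // (fE L) ?EM //=; apply: perm_inj.
  - have := memf L u LC uL; rewrite fuv fN //= => vL.
    by have := nv L LC; rewrite vL.
  - have := memf M v MC vM; rewrite -fuv fN //= => uM.
    by have := nu M MC; rewrite uM.
  - by move: fuv; rewrite !fN.
pose s := perm f_inj; pose k := [ffun v => (f v).2].
have orbE L v : L \in C -> v \in loop_vertices L ->
    porbit s v = loop_vertices L /\ steps (s, k) (porbit s v) = L.
  move=> LC vL; have [LE _] := LP L v LC vL.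
  have vE : loop_vertices L = porbit (x0 L).1 v by rewrite {1}LE loop_vertices_steps.
  have oE : porbit s v = porbit (x0 L).1 v.
    by apply: eq_in_porbit => u; rewrite -vE => uL; rewrite permE (fE L).
  rewrite oE vE; split=> //; rewrite [RHS]LE; apply: eq_in_imset => u.
  by rewrite -vE => uL; rewrite /= permE ffunE (fE L).
have sN v : (forall L, L \in C -> v \notin loop_vertices L) -> s v = v.
  by move=> nv; rewrite permE fN.
have okL L v : L \in C -> v \in loop_vertices L -> step_ok G (v, s v, k v).
  move=> LC vL; have [_ ok] := LP L v LC vL.
  by rewrite permE ffunE (fE L) //=; apply: ok; rewrite porbit_id.
exists (s, k); split.
- apply/forallP => v /=; case: (inC v) => [[L LC vL]|nv].
    have [_ LE] := orbE L v LC vL; rewrite -(card_dashed_steps (s, k)) LE.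
    by case/andP: (loopC L LC).
  have -> : [set u in porbit s v | k u] = set0.
    apply/setP => u; rewrite !inE; apply/negP => /andP[uv ku].
    have : u \in [set v].
      apply: (porbit_subP (P := fun w => w \in [set v])) uv; rewrite ?inE // => w.
      by rewrite !inE => /eqP->; rewrite sN.
    by rewrite inE => /eqP uE; move: ku; rewrite uE ffunE fN.
  by rewrite cards0.
- apply/forallP => v /=; case: (inC v) => [[L LC vL]|nv]; first by apply/orP; left; apply: (okL L).
  by rewrite sN // ffunE fN // eqxx orbT.
- apply/setP => L; apply/orbit_loopsP/idP => /= [[v [sv ->]]|LC].
    case: (inC v) => [[M MC vM]|/sN sE]; last by rewrite sE eqxx in sv.
    by have [_ ->] := orbE M v MC vM.
  have [v [LE _]] := x0P L LC.
  have vL : v \in loop_vertices L by rewrite LE loop_vertices_steps porbit_id.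
  have [_ <-] := orbE L v LC vL; exists v; split=> //.
  by apply: contraTneq (okL L v LC vL) => ->; rewrite step_ok_irr.
Qed.

(** All products, the sign of the permutation included, are regrouped by orbits and compared orbit
    by orbit: a nontrivial orbit gives a loop weight, a fixed point a vertex weight. *)
Lemma config_weight_orbit_loops x : even_orbits x -> ok_steps G x ->
  config_weight G (orbit_loops x) = term G x.
Proof.
move=> ev ok; rewrite /config_weight /term.
under [X in _ * X = _]eq_bigl => v do rewrite mem_loop_cover negbK.
rewrite big_imset /=; last first.
  by move=> O1 O2 _ _ /(congr1 (@loop_vertices V)); rewrite !loop_vertices_steps.
rewrite big_mkcond /= [X in _ * X = _]big_mkcond /= (big_porbits _ x.1).
rewrite [in RHS](big_porbits _ x.1) signr_porbits.
rewrite -big_split /= [X in X * _](_ : _ =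
  \prod_(O in porbits x.1) (if (1 < #|O|)%N then loop_weight G (steps x O) else 1)).
  rewrite -big_split /=; apply: eq_bigr => _ /imsetP[v _ ->].
  case: ifP => lt1.
    have sv : x.1 v != v by rewrite -porbit_trivial -ltnNge.
    rewrite -signr_odd (negbTE (orbit_even (ok_stepsP ok sv))) mulN1r.
    rewrite big1 ?mulr1 => [|u uO]; last first.
      by have := ok_stepsP ok sv uO; case: eqP => // ->; rewrite step_ok_irr.
    rewrite /loop_weight big_imset /=; last by move=> u w _ _ [].
    congr (- _); apply: eq_bigr => u uO; rewrite /entry.
    by rewrite (ok_stepsP ok sv uO).
  have /eqP sv : x.1 v == v by rewrite -porbit_trivial leqNgt lt1.
  have -> : porbit x.1 v = [set v].
    apply/eqP; rewrite eq_sym eqEcard cards1 porbit_trivial sv eqxx andbT sub1set.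
    exact: porbit_id.
  rewrite !big_set1 sv eqxx cards1 expr1 opprK mul1r mul1r /entry.
  have := forallP ok v; rewrite sv step_ok_irr eqxx /= => kv.
  by rewrite kv.
rewrite [RHS]big_mkcond; apply: eq_bigr => O _; rewrite inE.
by case: (O \in porbits _).
Qed.

Lemma dicot_partitionE : dicot_partition G = leibniz (kasteleyn G).
Proof.
rewrite leibniz_terms sum_terms /dicot_partition.
pose D := [set x | even_orbits x && ok_steps G x].
rewrite (eq_bigl (mem (@orbit_loops V @: D))) => [|C]; last first.
  apply/idP/imsetP => [/orbit_loops_onto[x [ev ok <-]] | [x]].
    by exists x; rewrite // inE ev ok.
  by rewrite inE => /andP[ev ok] ->; apply: orbit_loops_config.
rewrite big_imset => [|x y]; last by rewrite !inE; apply: orbit_loops_inj.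
apply: eq_big => x; rewrite inE // => /andP[]; exact: config_weight_orbit_loops.
Qed.

End LoopExpansion.

(** * Determinants indexed by a finite type, and a block determinant *)

Section Transport.
Variables (T U : finType) (f : T -> U) (g : U -> T).
Hypotheses (fK : cancel f g) (gK : cancel g f).

Lemma conj_bij_inj (s : {perm T}) : injective (fun u => f (s (g u))).
Proof. by move=> u v /(can_inj fK)/perm_inj/(can_inj gK). Qed.

Definition perm_transport (s : {perm T}) : {perm U} := perm (@conj_bij_inj s).

Lemma porbit_transport s i : porbit (perm_transport s) (f i) = f @: porbit s i.
Proof.
have it m : (perm_transport s ^+ m)%g (f i) = f ((s ^+ m)%g i).
  by elim: m => [|m IHm]; rewrite ?expg0 ?perm1 // !expgSr !permM IHm permE fK.
apply/setP => u; apply/porbitP/imsetP => [[m ->]|[_ /porbitP[m ->] ->]].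
  by exists ((s ^+ m)%g i); rewrite ?mem_porbit.
by exists m.
Qed.

(** Parity depends only on the numbers of points and of orbits, and the bijection carries orbits to
    orbits. *)
Lemma odd_perm_transport s : odd_perm (perm_transport s) = odd_perm s.
Proof.
rewrite /odd_perm (bij_eq_card (Bijective fK gK)); congr (_ (+) odd _).
rewrite -(card_imset _ (imset_inj (can_inj fK))); apply: eq_card => O.
apply/imsetP/imsetP => [[u _ ->]|[_ /imsetP[i _ ->] ->]].
  by exists (porbit s (g u)); rewrite ?imset_f // -porbit_transport gK.
by exists (f i); rewrite // porbit_transport.
Qed.
End Transport.

Lemma perm_transportK (T U : finType) (f : T -> U) (g : U -> T)
    (fK : cancel f g) (gK : cancel g f) :
  cancel (perm_transport fK gK) (perm_transport gK fK).
Proof. by move=> s; apply/permP => i; rewrite !permE !fK. Qed.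

Lemma det_leibniz (R : rcfType) (V : finType) n (f : 'I_n -> V)
    (K : V -> V -> R[i]%C) : bijective f ->
  \det (\matrix_(i, j) K (f i) (f j)) = leibniz K.
Proof.
case=> g fK gK; rewrite /leibniz.
rewrite (reindex (perm_transport fK gK)); last first.
  exact: onW_bij (Bijective (perm_transportK fK gK) (perm_transportK gK fK)).
apply: eq_bigr => s _; rewrite odd_perm_transport; congr (_ * _).
rewrite (reindex f); last exact: onW_bij (Bijective fK gK).
by apply: eq_bigr => i _; rewrite mxE permE fK.
Qed.

(** Conjugation by a unipotent block triangular matrix makes the block matrix upper triangular; the
    lower left block becomes [- B - c ^+ 2 *: B], which is zero. *)
Lemma det_antisym_block (F : comPzRingType) n (c : F) (A B : 'M[F]_n) :
  c ^+ 2 = -1 ->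
  \det (block_mx A B (- B) A) = \det (A + c *: B) * \det (A - c *: B).
Proof.
move=> c2; rewrite -(det_ublock _ B).
have <- : block_mx 1%:M 0 (- c)%:M 1%:M *m block_mx A B (- B) A *m
          block_mx 1%:M 0 c%:M 1%:M = block_mx (A + c *: B) B 0 (A - c *: B).
  rewrite !mulmx_block !mul1mx !mul0mx !mulmx0 !mulmx1 !mul_scalar_mx !mul_mx_scalar.
  rewrite !add0r !addr0; congr block_mx; last by rewrite scaleNr addrC.
  rewrite scalerDr scalerA mulrN -expr2 c2 opprK scale1r scaleNr.
  by rewrite addrA addrNK addNr.
by rewrite !det_mulmx !det_lblock !det1 !mul1r mulr1.
Qed.

(** * The conjugate Kasteleyn matrix and its determinant *)

Section Conjugate.
Variables (R : rcfType) (V : finType) (G : dicot R V).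

(** Solid and vertex entries are real and dashed ones purely imaginary, so this is the complex
    conjugate of [kasteleyn]. *)
Definition kasteleyn_conj (u v : V) : R[i]%C :=
  entry G (u, v, false) - entry G (u, v, true).

Lemma entry_color (c : V -> bool) u v b :
  (forall u v, solid G u v || dashed G u v -> c u != c v) -> u != v ->
  (-1) ^+ (c u) * entry G (u, v, b) * (-1) ^+ (c v) = - entry G (u, v, b).
Proof.
move=> Hc uv; rewrite /entry /= (negbTE uv); case: ifP => [ok|_]; last first.
  by rewrite mulr0 mul0r oppr0.
have /Hc : solid G u v || dashed G u v by move: ok; case: (b) => ->; rewrite ?orbT.
by case: (c u) (c v) => [] [] // _; rewrite !(expr0, expr1) ?mulN1r ?mul1r ?mulr1 ?mulrN1.
Qed.

(* Transposing changes the sign of the solid entries, and changing the signs of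
   the rows and columns of one colour class changes that of all the
   off-diagonal ones. *)
Lemma det_kasteleyn_conj n (f : 'I_n -> V) : injective f ->
  \det (\matrix_(i, j) kasteleyn_conj (f i) (f j)) =
  \det (\matrix_(i, j) kasteleyn G (f i) (f j)).
Proof.
move=> f_inj; have [c Hc] := dicot_bip G; set K := (X in _ = \det X).
pose d : 'rV[R[i]%C]_n := \row_i (-1) ^+ c (f i).
have -> : \matrix_(i, j) kasteleyn_conj (f i) (f j) = diag_mx d *m K^T *m diag_mx d.
  apply/matrixP => i j; rewrite mul_mx_diag mul_diag_mx !mxE /kasteleyn_conj /kasteleyn.
  have [-> | ne] := eqVneq i j.
    rewrite /entry !step_ok_irr /= eqxx /= addr0 subr0 mulrAC -expr2 sqrr_sign.
    by rewrite mul1r.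
  have nef : f i != f j by rewrite (inj_eq f_inj).
  rewrite !(entry_rev _ _ nef) mulrDr mulrDl expr0 expr1 opprK mul1r mulN1r mulrN mulNr.
  by rewrite !entry_color // opprK.
rewrite !det_mulmx det_tr mulrAC -det_mulmx mulmx_diag (_ : diag_mx _ = 1%:M) ?det1 ?mul1r //.
rewrite -diag_const_mx; congr diag_mx; apply/rowP => i.
by rewrite !mxE -expr2 sqrr_sign.
Qed.
End Conjugate.

(** * Block form of the Kasteleyn matrix of [G] over the quotient *)

Section Quotient.
Variables (R : rcfType) (V : finType) (G : bigraph R V) (pi : {perm V}).
Variables (P1 P2 : {set V}) (aut : automorphism G pi) (inv : involutive pi).
Hypothesis adap : adapted G pi P1 P2.
Hypothesis bip : bipartite (fun u v : part P1 =>
  quotient_solid G u v || quotient_dashed G pi u v).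

Let Q := quotient_dicot aut inv bip.
Let GD := dicot_of_graph G.

Definition dashed_entry (u v : part P1) : R[i]%C :=
  if quotient_dashed G pi u v then (gedge G (val u) (pi (val v)))%:C%C else 0.

Lemma pi_notin v : v \in P1 -> pi v \notin P1.
Proof.
by rewrite (adapted_swap adap) => pv; rewrite (disjointFl (adapted_disjoint adap) pv).
Qed.

Lemma neq_pi u v : u \in P1 -> v \in P1 -> (u == pi v) = false.
Proof. by move=> uP vP; apply: contraTF uP => /eqP->; rewrite pi_notin. Qed.

Lemma kasteleyn_graph u v : kasteleyn GD u v = entry GD (u, v, false).
Proof. by rewrite /kasteleyn [X in _ + X]/entry /= andbF addr0. Qed.

Lemma kasteleyn_graphE u v : kasteleyn GD u v =
  if gadj G u v then
    if gorient G u v then (gedge G u v)%:C%C else - (gedge G u v)%:C%C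
  else if u == v then (gvertex G u)%:C%C else 0.
Proof. by rewrite kasteleyn_graph /entry /= andbT. Qed.

Lemma entry_quotient_dashed u v :
  entry Q (u, v, true) = ('i * dashed_entry u v)%C.
Proof. by rewrite /entry /dashed_entry /= andbF; case: ifP => // _; rewrite mulr0. Qed.

Lemma kasteleyn_inner (u v : part P1) :
  kasteleyn GD (val u) (val v) = entry Q (u, v, false).
Proof. by rewrite kasteleyn_graphE /entry /= andbT. Qed.

Lemma kasteleyn_inner_pi (u v : part P1) :
  kasteleyn GD (pi (val u)) (pi (val v)) = entry Q (u, v, false).
Proof.
rewrite -kasteleyn_inner !kasteleyn_graphE (auto_adj aut) (inj_eq perm_inj).
rewrite (auto_vertex aut); case: ifP => // uv.
by rewrite (auto_edge aut uv) (adapted_inner adap (valP u) (valP v) uv).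
Qed.

Lemma quotient_dashedE (u v : part P1) :
  quotient_dashed G pi u v = gadj G (val u) (pi (val v)).
Proof.
rewrite /quotient_dashed; case: eqP => //= <-.
by rewrite (negbTE (adapted_nonadj adap (valP u))).
Qed.

(** The two edges are exchanged by [pi], hence have equal weights, and both point the same way
    between [P1] and [P2]. One entry runs from [P1] to [P2] and the other back, whence the opposite
    signs; [b] records the common direction. *)
Lemma kasteleyn_cross : exists b : bool, forall u v : part P1,
  kasteleyn GD (val u) (pi (val v)) = (-1) ^+ b * dashed_entry u v /\
  kasteleyn GD (pi (val u)) (val v) = - ((-1) ^+ b * dashed_entry u v).
Proof.
have adjC (u v : part P1) : gadj G (pi (val u)) (val v) = gadj G (val u) (pi (val v)).
  by rewrite -(auto_adj aut) inv.
have gedgeC (u v : part P1) : gadj G (val u) (pi (val v)) ->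
    gedge G (pi (val u)) (val v) = gedge G (val u) (pi (val v)).
  by rewrite -adjC => uv; rewrite -(auto_edge aut uv) inv.
have flipo (u v : part P1) : gadj G (val u) (pi (val v)) ->
    gorient G (pi (val u)) (val v) = ~~ gorient G (val v) (pi (val u)).
  by rewrite -adjC; apply: gorientP.
have flipo' (u v : part P1) : gadj G (val u) (pi (val v)) ->
    gorient G (val u) (pi (val v)) = ~~ gorient G (pi (val v)) (val u).
  exact: gorientP.
have neq (u v : part P1) :
    ((val u == pi (val v)) = false) * ((pi (val u) == val v) = false).
  by rewrite [pi _ == _]eq_sym !(neq_pi (valP _) (valP _)).
case: (adapted_cross adap) => cross; [exists false | exists true] => u v;
  rewrite !kasteleyn_graphE adjC /dashed_entry quotient_dashedE !neq.
all: case: ifP => uv; last by rewrite mulr0 oppr0.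
all: have [o1 o2] := cross _ _ (valP u) (valP v) uv.
  by rewrite o1 flipo // o2 gedgeC // expr0 mul1r.
by rewrite flipo' // o1 o2 gedgeC // expr1 mulN1r opprK.
Qed.

Definition double_cover (i : 'I_(#|part P1| + #|part P1|)) : V :=
  match split i with
  | inl j => val (enum_val j)
  | inr j => pi (val (enum_val j))
  end.

Lemma double_cover_bij : bijective double_cover.
Proof.
(* Injectivity holds because [pi] sends [P1] outside [P1]; surjectivity follows by counting, as [P1]
   and [P2] have the same size and partition [V]. *)
apply: inj_card_bij.
  move=> i j; rewrite /double_cover -{2}(splitK i) -{2}(splitK j).
  case: (split i) (split j) => a [] b /=.
  - by move/val_inj/enum_val_inj->.
  - by move/eqP; rewrite (neq_pi (valP _) (valP _)).
  - by move/esym/eqP; rewrite (neq_pi (valP _) (valP _)).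
  - by move/perm_inj/val_inj/enum_val_inj->.
rewrite card_ord card_sig -cardsT -(adapted_cover adap) cardsU.
by rewrite (disjoint_setI0 (adapted_disjoint adap)) cards0 subn0 -(adapted_card adap).
Qed.

Lemma kasteleyn_blocks : exists b : bool,
  \matrix_(i, j) kasteleyn GD (double_cover i) (double_cover j) =
  let A := \matrix_(i, j) entry Q (enum_val i, enum_val j, false) in
  let B := (-1) ^+ b *: \matrix_(i, j) dashed_entry (enum_val i) (enum_val j) in
  block_mx A B (- B) A.
Proof.
have [b cross] := kasteleyn_cross; exists b.
apply/matrixP => i j; rewrite mxE /double_cover -{2}(splitK i) -{2}(splitK j).
case: (split i) (split j) => a [] c /=.
- by rewrite block_mxEul !mxE kasteleyn_inner.
- by rewrite block_mxEur !mxE; case: (cross (enum_val a) (enum_val c)).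
- by rewrite block_mxEdl !mxE; case: (cross (enum_val a) (enum_val c)).
- by rewrite block_mxEdr !mxE kasteleyn_inner_pi.
Qed.

Lemma leibniz_quotient :
  leibniz (kasteleyn GD) = leibniz (kasteleyn Q) ^+ 2.
Proof.
rewrite -(det_leibniz _ double_cover_bij) -(det_leibniz _ (@enum_val_bij (part P1))).
have [b ->] := kasteleyn_blocks; set A := \matrix_(i, j) entry Q _.
rewrite /= (det_antisym_block _ _ (sqr_i R)).
set B := \matrix_(i, j) dashed_entry _ _.
have plus : A + 'i%C *: B = \matrix_(i, j) kasteleyn Q (enum_val i) (enum_val j).
  by apply/matrixP => i j; rewrite !mxE /kasteleyn entry_quotient_dashed.
have minus : A - 'i%C *: B = \matrix_(i, j) kasteleyn_conj Q (enum_val i) (enum_val j).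
  by apply/matrixP => i j; rewrite !mxE /kasteleyn_conj entry_quotient_dashed.
have detE : \det (A - 'i%C *: B) = \det (A + 'i%C *: B).
  by rewrite plus minus det_kasteleyn_conj //; apply: enum_val_inj.
(* Reversing the direction of all cross edges replaces [B] by its opposite, which only swaps the two
   factors. *)
rewrite -plus; case: b; last by rewrite expr0 scale1r detE expr2.
by rewrite expr1 scaleN1r scalerN opprK detE expr2.
Qed.
End Quotient.

Theorem theorem3p4 (R : rcfType) (V : finType) (G : bigraph R V)
    (pi : {perm V}) (P1 P2 : {set V})
    (aut : automorphism G pi)
    (inv : involutive pi)
    (fixfree : forall v, pi v != v)
    (adap : adapted G pi P1 P2)
    (bip : bipartite (fun u v : part P1 =>
             quotient_solid G u v || quotient_dashed G pi u v)) :
  graph_partition G = dicot_partition (quotient_dicot aut inv bip) ^+ 2.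
Proof.
by rewrite /graph_partition !dicot_partitionE; apply: leibniz_quotient adap bip.
Qed.
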